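(* Let $b_0 \leq b_1 \leq b_2 \leq \cdots$ be a nondecreasing sequence of nonnegative integers. For $n \geq 0$, let $f(n)$ denote the number of integer sequences $(a_0, a_1, \ldots, a_n)$ with $0 \leq a_0 \leq a_1 \leq \cdots \leq a_n$ and $a_j \leq b_j$ for all $0 \leq j \leq n$. Then the identity $$1 = (1-x)^{1 + b_0} + \sum_{n \geq 0} f(n)\, x^{n+1} (1-x)^{1+b_{n+1}}$$ holds in the ring $\mathbb{C}[[x]]$ of formal power series in $x$.
   Context: The infinite sum converges in $\mathbb{C}[[x]]$ since each term $x^{n+1}(1-x)^{1+b_{n+1}}$ has no monomials of degree less than $n+1$. *)

(* Defs.v *)
From HB Require Import structures.
From mathcomp Require Import all_boot all_order all_algebra.
From mathcomp Require Import all_classical all_reals all_analysis.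
From mathcomp Require Export complex.

Set Implicit Arguments.
Unset Strict Implicit.
Unset Printing Implicit Defensive.

Import Order.TTheory GRing.Theory Num.Theory.

Local Open Scope classical_set_scope.
Local Open Scope ring_scope.

(* [{| fps_coef := c |}] stands for the series c 0 + c 1 x + c 2 x^2 + ...;
   a record rather than a bare function type, since [nat -> K] already carries
   the pointwise product. *)
Record fps (K : comNzRingType) := Fps { fps_coef : nat -> K }.

HB.instance Definition _ (K : comNzRingType) := gen_eqMixin (fps K).
HB.instance Definition _ (K : comNzRingType) := gen_choiceMixin (fps K).

Section FpsRing.
Variable K : comNzRingType.
Implicit Types f g h : fps K.

Lemma fpsP f g : (forall n, fps_coef f n = fps_coef g n) -> f = g.
Proof. by case: f g => [f] [g] /= fg; congr Fps; apply/funext. Qed.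

Definition fps0 : fps K := Fps (fun=> 0).
Definition fps_opp f : fps K := Fps (fun n => - fps_coef f n).
Definition fps_add f g : fps K := Fps (fun n => fps_coef f n + fps_coef g n).
Definition fps1 : fps K := Fps (fun n => (n == 0%N)%:R).
Definition fps_mul f g : fps K :=
  Fps (fun n => \sum_(i < n.+1) fps_coef f i * fps_coef g (n - i)%N).

Lemma fps_addA : associative fps_add.
Proof. by move=> f g h; apply: fpsP => n /=; rewrite addrA. Qed.

Lemma fps_addC : commutative fps_add.
Proof. by move=> f g; apply: fpsP => n /=; rewrite addrC. Qed.

Lemma fps_add0 : left_id fps0 fps_add.
Proof. by move=> f; apply: fpsP => n /=; rewrite add0r. Qed.

Lemma fps_addN : left_inverse fps0 fps_opp fps_add.
Proof. by move=> f; apply: fpsP => n /=; rewrite addNr. Qed.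

HB.instance Definition _ :=
  GRing.isZmodule.Build (fps K) fps_addA fps_addC fps_add0 fps_addN.

Definition fps_trunc n f : {poly K} := \poly_(i < n.+1) fps_coef f i.

Lemma fps_truncE n f i : (i <= n)%N -> (fps_trunc n f)`_i = fps_coef f i.
Proof. by move=> le_in; rewrite coef_poly ltnS le_in. Qed.

Lemma fps_trunc_mul n f g i : (i <= n)%N ->
  fps_coef (fps_mul f g) i = (fps_trunc n f * fps_trunc n g)`_i.
Proof.
move=> le_in; rewrite coefM; apply: eq_bigr => j _.
rewrite !fps_truncE //; first exact: leq_trans (leq_subr _ _) le_in.
by apply: leq_trans le_in; rewrite -ltnS.
Qed.

Lemma fps_mulC : commutative fps_mul.
Proof.
by move=> f g; apply: fpsP => n; rewrite !(@fps_trunc_mul n) // mulrC.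
Qed.

Lemma fps_mulA : associative fps_mul.
Proof.
move=> f g h; apply: fpsP => n.
transitivity (fps_trunc n f * fps_trunc n g * fps_trunc n h)`_n.
  rewrite -mulrA coefM /=; apply: eq_bigr => i _; congr (_ * _).
    by rewrite fps_truncE // -ltnS.
  by rewrite -fps_trunc_mul // leq_subr.
rewrite coefM /=; apply: eq_bigr => i _; congr (_ * _).
  by rewrite -fps_trunc_mul // -ltnS.
by rewrite fps_truncE // leq_subr.
Qed.

Lemma fps_mul1 : left_id fps1 fps_mul.
Proof.
move=> f; apply: fpsP => n /=; rewrite big_ord_recl /= subn0 mul1r.
by rewrite big1 ?addr0 // => i _; rewrite mul0r.
Qed.

Lemma fps_mulD : left_distributive fps_mul fps_add.
Proof.
move=> f g h; apply: fpsP => n /=; rewrite -big_split /=.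
by apply: eq_bigr => i _; rewrite mulrDl.
Qed.

Lemma fps1_neq0 : fps1 != 0.
Proof.
apply/eqP => /(congr1 (fun f => fps_coef f 0)) /= /eqP.
by rewrite oner_eq0.
Qed.

HB.instance Definition _ := GRing.Zmodule_isComNzRing.Build (fps K)
  fps_mulA fps_mulC fps_mul1 fps_mulD fps1_neq0.

Definition fpsX : fps K := Fps (fun n => (n == 1%N)%:R).

HB.instance Definition _ := isPointed.Build (fps K) 0.

(* The (x)-adic topology: agreement of the coefficients below degree n is
   congruence modulo x^n. *)
Definition fps_nbhs f : set_system (fps K) :=
  filter_from [set: nat] (fun n =>
    [set g | forall i, (i < n)%N -> fps_coef g i = fps_coef f i]).

HB.instance Definition _ := hasNbhs.Build (fps K) fps_nbhs.

Lemma fps_nbhs_filter f : ProperFilter (nbhs f).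
Proof.
apply: filter_from_proper; last by move=> n _; exists f.
apply: filter_from_filter; first by exists 0.
move=> m n _ _; exists (maxn m n) => // g fg.
by split=> i lt_i; apply: fg; rewrite leq_max lt_i ?orbT.
Qed.

Lemma fps_nbhs_singleton f (A : set (fps K)) : nbhs f A -> A f.
Proof. by case=> n _; apply. Qed.

Lemma fps_nbhs_nbhs f (A : set (fps K)) : nbhs f A -> nbhs f (nbhs^~ A).
Proof.
case=> n _ sA; exists n => // g fg; exists n => // h gh.
by apply: sA => i lt_in; rewrite gh ?fg.
Qed.

HB.instance Definition _ := Nbhs_isNbhsTopological.Build (fps K)
  fps_nbhs_filter fps_nbhs_singleton fps_nbhs_nbhs.

End FpsRing.

Arguments fpsX {K}.

(* The number of a_0 <= ... <= a_n in the naturals with a_j <= b j: the j-th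
   factor of the dependent product is {0, ..., b j}. *)
Definition nb_bounded_seq (b : nat -> nat) (n : nat) : nat :=
  #|[set a : {dffun forall j : 'I_n.+1, 'I_(b j).+1} |
      [forall i : 'I_n.+1, forall j : 'I_n.+1, (i <= j)%N ==> (a i <= a j)%N]]%SET|.

(* Main.v *)
(** Write [A n] for the set of sequences counted by [f n], and put
    [P n = x ^ (n+1) * \sum_(a in A n) (1 - x) ^ (a_n)].
    Since [y ^ k - y ^ (m+1) = (1 - y) * \sum_(k <= j <= m) y ^ j], taking
    [y = 1 - x], [k = a_n] and [m = b_(n+1)] gives
    [P n - f n * x ^ (n+1) * (1 - x) ^ (1 + b_(n+1)) = P (n+1)], because the
    exponents [j] run over the possible extensions [a_(n+1) = j] of [a].
    As [P 0 = 1 - (1 - x) ^ (1 + b_0)], the [P n] are the remainders of the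
    series, and [x ^ (n+1)] divides [P n]. *)
Require Import Defs.
From mathcomp Require Import all_boot all_order all_algebra.
From mathcomp Require Import all_classical all_reals all_analysis.

Set Implicit Arguments.
Unset Strict Implicit.
Unset Printing Implicit Defensive.

Import Order.TTheory GRing.Theory Num.Theory.

Local Open Scope classical_set_scope.
Local Open Scope ring_scope.

(** * Bounded nondecreasing sequences, extended by a last entry *)

Section BoundedSequences.
Variable b : nat -> nat.

Definition seq_below (n : nat) := {dffun forall j : 'I_n.+1, 'I_(b j).+1}.

Definition bounded_seqs (n : nat) : {set seq_below n} :=
  [set a : seq_below n |
    [forall i : 'I_n.+1, forall j : 'I_n.+1, (i <= j)%N ==> (a i <= a j)%N]]%SET.

Lemma bounded_seqsP n (a : seq_below n) :
  reflect (forall i j : 'I_n.+1, (i <= j)%N -> (a i <= a j)%N)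
          (a \in bounded_seqs n).
Proof.
rewrite inE; apply: (iffP forallP) => [h i j le_ij | h i].
  by have /forallP/(_ j)/implyP := h i; apply.
by apply/forallP => j; apply/implyP; apply: h.
Qed.

(** The codomain depends on the index, so [inord] moves each entry into the type at [j]. It never
    truncates: the entry already obeys the bound there. *)
Definition rcons_below n (a : seq_below n) (k : 'I_(b n.+1).+1) :
    seq_below n.+1 :=
  [ffun j : 'I_n.+2 =>
     inord (if (j < n.+1)%N then a (inord j) : nat else k) : 'I_(b j).+1].

Definition belast_below n (a : seq_below n.+1) : seq_below n :=
  [ffun i : 'I_n.+1 => (a (widen_ord (leqnSn n.+1) i) : 'I_(b i).+1)].

Lemma rcons_below_max n (a : seq_below n) k :
  rcons_below a k ord_max = k :> nat.
Proof. by rewrite ffunE /= ltnn inordK. Qed.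

Lemma rcons_below_lt n (a : seq_below n) k (i : 'I_n.+1) (j : 'I_n.+2) :
  i = j :> nat -> rcons_below a k j = a i :> nat.
Proof.
by move=> eq_ij; rewrite ffunE -eq_ij ltn_ord inord_val inordK.
Qed.

Lemma belast_belowE n (a : seq_below n.+1) (i : 'I_n.+1) (j : 'I_n.+2) :
  i = j :> nat -> belast_below a i = a j :> nat.
Proof.
move=> eq_ij; rewrite ffunE.
by have <- : widen_ord (leqnSn n.+1) i = j by apply: val_inj.
Qed.

Lemma rcons_belowK n (a : seq_below n) k : belast_below (rcons_below a k) = a.
Proof.
apply/ffunP => i; apply: val_inj => /=.
by rewrite (@belast_belowE _ _ i (widen_ord (leqnSn _) i)) // (@rcons_below_lt _ _ _ i).
Qed.

Lemma belast_belowK n (a : seq_below n.+1) :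
  rcons_below (belast_below a) (a ord_max) = a.
Proof.
apply/ffunP => j; apply: val_inj => /=.
have [lt_jn | le_nj] := ltnP j n.+1.
  rewrite (@rcons_below_lt _ _ _ (Ordinal lt_jn)) //.
  exact: belast_belowE.
have -> : j = ord_max.
  by apply/val_inj/eqP; rewrite /= eqn_leq le_nj -ltnS ltn_ord.
exact: rcons_below_max.
Qed.

Lemma rcons_below_bounded n (a : seq_below n) (k : 'I_(b n.+1).+1) :
  (rcons_below a k \in bounded_seqs n.+1) =
  (a \in bounded_seqs n) && (a ord_max <= k)%N.
Proof.
apply/bounded_seqsP/andP => [h | [/bounded_seqsP h le_ak] i j le_ij].
  split.
    apply/bounded_seqsP => i j le_ij.
    rewrite -(@rcons_below_lt n a k i (widen_ord (leqnSn _) i)) //.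
    by rewrite -(@rcons_below_lt n a k j (widen_ord (leqnSn _) j)) //; apply: h.
  rewrite -(@rcons_below_lt n a k _ (widen_ord (leqnSn _) ord_max)) //.
  by rewrite -[leqRHS](rcons_below_max a); apply: h => /=.
have [lt_jn | le_nj] := ltnP j n.+1.
  have lt_in := leq_ltn_trans le_ij lt_jn.
  rewrite (@rcons_below_lt _ _ _ (Ordinal lt_in) i) //.
  by rewrite (@rcons_below_lt _ _ _ (Ordinal lt_jn) j) //; apply: h.
have {le_ij le_nj}-> : j = ord_max.
  by apply/val_inj/eqP; rewrite /= eqn_leq le_nj -ltnS ltn_ord.
rewrite rcons_below_max.
have [lt_in | le_ni] := ltnP i n.+1.
  rewrite (@rcons_below_lt _ _ _ (Ordinal lt_in)) //.
  by apply: leq_trans le_ak; apply: h; rewrite /= -ltnS.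
have -> : i = ord_max.
  by apply/val_inj/eqP; rewrite /= eqn_leq le_ni -ltnS ltn_ord.
by rewrite rcons_below_max.
Qed.

(** Deleting the last entry is a bijection onto pairs [(a, k)] with [k] between the last entry of
    [a] and [b n.+1]. *)
Lemma sum_bounded_seqsS (V : nmodType) (F : nat -> V) n :
  \sum_(a in bounded_seqs n.+1) F (a ord_max) =
  \sum_(a in bounded_seqs n) \sum_(a ord_max <= j < (b n.+1).+1) F j.
Proof.
under [RHS]eq_bigr do rewrite big_geq_mkord.
rewrite pair_big_dep /=.
rewrite (reindex (fun p => rcons_below p.1 p.2)) /=; last first.
  exists (fun a => (belast_below a, a ord_max)) => [[a k] _ | a _] /=.
    rewrite rcons_belowK; congr (_, _).
    by apply: val_inj; rewrite /= rcons_below_max.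
  exact: belast_belowK.
apply: eq_big => [[a k] | [a k] _] /=; first by rewrite rcons_below_bounded.
by rewrite rcons_below_max.
Qed.

Lemma sum_bounded_seqs0 (V : nmodType) (F : nat -> V) :
  \sum_(a in bounded_seqs 0) F (a ord_max) = \sum_(0 <= j < (b 0).+1) F j.
Proof.
rewrite big_mkord.
rewrite (reindex (fun k : 'I_(b 0).+1 =>
   [ffun j : 'I_1 => inord k : 'I_(b j).+1] : seq_below 0)) /=; last first.
  exists (fun a => a ord0) => [k _ | a _] /=.
    by apply: val_inj; rewrite /= ffunE inordK.
  apply/ffunP => j; rewrite ffunE; apply: val_inj.
  by rewrite (ord1 j) /= inordK.
apply: eq_big => [k | k _]; last by rewrite ffunE inordK.
by apply/bounded_seqsP => i j _; rewrite (ord1 i) (ord1 j).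
Qed.

(** * Remainders of the series, in any commutative ring *)

Section Remainder.
Hypothesis b_nondecreasing : {homo b : m n / (m <= n)%N}.
Variables (A : comNzRingType) (x : A).

(** The sum telescopes, since [x * (1 - x) ^+ j] is [(1 - x) ^+ j - (1 - x) ^+ j.+1]. *)
Lemma mul_sum_geom k m : (k <= m)%N ->
  x * \sum_(k <= j < m) (1 - x) ^+ j = (1 - x) ^+ k - (1 - x) ^+ m.
Proof.
move=> le_km; rewrite -[RHS]opprB.
have /= <- := telescope_sumr (fun j => (1 - x) ^+ j) le_km.
rewrite -sumrN mulr_sumr.
by apply: eq_bigr => j _; rewrite exprS mulrBl mul1r opprB subKr.
Qed.

Definition remainder n : A :=
  x ^+ n.+1 * \sum_(a in bounded_seqs n) (1 - x) ^+ (a ord_max).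

Lemma remainder0 : remainder 0 = 1 - (1 - x) ^+ (1 + b 0).
Proof.
rewrite /remainder (sum_bounded_seqs0 (fun j => (1 - x) ^+ j)) expr1.
by rewrite mul_sum_geom.
Qed.

Lemma remainderS n :
  remainder n.+1 = remainder n
    - (nb_bounded_seq b n)%:R * x ^+ n.+1 * (1 - x) ^+ (1 + b n.+1).
Proof.
rewrite /remainder (sum_bounded_seqsS (fun j => (1 - x) ^+ j)).
rewrite [_%:R * x ^+ _]mulrC -[_ * _%:R * _]mulrA -mulrBr exprSr -mulrA.
(* The count times a power becomes a constant sum over [bounded_seqs b n], so that both sides
   compare term by term. *)
congr (_ * _); rewrite mulr_sumr mulr_natl -sumr_const -sumrB.
apply: eq_bigr => a _; apply: mul_sum_geom.
(* The range of exponents is legitimate because [a ord_max <= b n <= b n.+1]; monotonicity of [b]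
   enters here. *)
apply: leqW; rewrite -ltnS; apply: leq_trans (ltn_ord _) _.
by rewrite ltnS; apply: b_nondecreasing.
Qed.

Lemma remainderE n :
  remainder n = 1 - (1 - x) ^+ (1 + b 0)
    - \sum_(0 <= i < n)
        (nb_bounded_seq b i)%:R * x ^+ i.+1 * (1 - x) ^+ (1 + b i.+1).
Proof.
elim: n => [|n IHn]; first by rewrite big_nil subr0 remainder0.
by rewrite remainderS IHn big_nat_recr //= opprD addrA.
Qed.

End Remainder.
End BoundedSequences.

(** * Limits in the (x)-adic topology *)

Section FpsTopology.
Variable K : comNzRingType.
Implicit Types f g : fps K.

Lemma fps_coefXnM_lt f n i : (i < n)%N -> fps_coef (fpsX ^+ n * f) i = 0.
Proof.
elim: n i => [//|n IHn] i lt_in; rewrite exprS -mulrA.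
apply: big1 => -[j lt_ji] _ /=.
(* Only [j = 1] meets a nonzero coefficient of [fpsX]; the other factor is then the coefficient of
   degree [i - 1]. *)
case: j lt_ji => [|[|j]] lt_ji; rewrite ?mul0r //.
rewrite mul1r; apply: IHn.
by case: i lt_in lt_ji => // i; rewrite subn1.
Qed.

(** Each coefficient is locally constant, hence separates points. This makes the value of an
    infinite sum unique. *)
Lemma fps_hausdorff : hausdorff_space (fps K).
Proof.
move=> f g fg; apply: fpsP => n.
have near_coef (h : fps K) : nbhs h [set k | fps_coef k n = fps_coef h n].
  by exists n.+1 => // k; apply.
by have [h [/= <- <-]] := fg _ _ (near_coef f) (near_coef g).
Qed.

Lemma fps_cvg (s : nat -> fps K) f :
  (forall n, exists g, f - s n = fpsX ^+ n * g) -> s n @[n --> \oo] --> f.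
Proof.
move=> sf B [m _ sB]; exists m => // n /= le_mn; apply: sB => i lt_im.
have [g fsg] := sf n; have := fps_coefXnM_lt g (leq_trans lt_im le_mn).
by rewrite -fsg /= => /eqP; rewrite subr_eq0 => /eqP.
Qed.

End FpsTopology.

Theorem theorem2 (R : realType) (b : nat -> nat)
    (b_nondecreasing : {homo b : m n / (m <= n)%N}) :
  let x : fps R[i] := fpsX in
  let u (n : nat) : fps R[i] :=
    (nb_bounded_seq b n)%:R * x ^+ n.+1 * (1 - x) ^+ (1 + b n.+1) in
  cvgn (series u) /\
  1 = (1 - x) ^+ (1 + b 0%N) + \big[+%R/0]_(0 <= n <oo) u n.
Proof.
move=> x u.
have u_cvg : series u n @[n --> \oo] --> 1 - (1 - x) ^+ (1 + b 0%N).
  apply: fps_cvg => n.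
  (* The error after [n] terms is [remainder b x n], divisible by [x ^+ n.+1]; the spare factor [x]
     goes into the witness. *)
  exists (x * \sum_(a in bounded_seqs b n) (1 - x) ^+ (a ord_max)).
  by rewrite mulrA -exprSr /series /= -remainderE.
split; first by apply/cvg_ex; exists (1 - (1 - x) ^+ (1 + b 0%N)).
have -> : \big[+%R/0]_(0 <= n <oo) u n = 1 - (1 - x) ^+ (1 + b 0%N).
  exact: (cvg_lim (@fps_hausdorff _) u_cvg).
by rewrite addrC subrK.
Qed.
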